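(* Let $\ell\ge3$ and let $(R_{ij},\Delta^0_i)_{ij}$ be an idempotent partial graded odd form ring of rank $\ell$. The associativity conditions hold for it if $\ell\ge4$ or if $R_{ij}=\langle\Delta^0_{-i}\circ\Delta^0_j\rangle$ for all non-zero $i,j$ with $|i|\ne|j|$.
   Context: **Partial graded odd form rings.** Indices are non-zero integers in $[-\ell,\ell]$; in each item, indices denoted by different letters have distinct absolute values. A partial graded odd form ring of rank $\ell$ is a family of groups $R_{ij}$ ($|i|\ne|j|$; operation $+$, a priori not commutative) and $\Delta^0_i$ (operation $\dotplus$, neutral element $\dot0$, inverse $\mathbin{\dot-}u$) with operations $\overline{(-)}\colon R_{ij}\to R_{-j,-i}$, $(a,b)\mapsto ab\colon R_{ij}\times R_{jk}\to R_{ik}$, $*\colon R_{-i,j}\times R_{ji}\to\Delta^0_i$, $\circ\colon\Delta^0_i\times\Delta^0_j\to R_{-i,j}$, $\triangleleft\colon\Delta^0_i\times R_{ij}\to R_{-i,j}$, $\cdot\colon\Delta^0_i\times R_{ij}\to\Delta^0_j$ satisfying $\overline{a+b}=\overline b+\overline a$, $\overline{\overline a}=a$ and (R1) $ab+c=c+ab$ for $a\in R_{ij},b\in R_{jk},c\in R_{ik}$; (R2) $(a+b)c=ac+bc$ for $a,b\in R_{ij}$, $c\in R_{jk}$; (R3) $a(b+c)=ab+ac$ for $a\in R_{ij}$, $b,c\in R_{jk}$; (R4) $\overline{ab}=\overline b\,\overline a$ for $a\in R_{ij}$, $b\in R_{jk}$; (R5) $a*b\dotplus u=u\dotplus a*b$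 for $a\in R_{-i,j},b\in R_{ji},u\in\Delta^0_i$; (R6) $(a+b)*c=a*c\dotplus b*c$ for $a,b\in R_{-i,j},c\in R_{ji}$; (R7) $a*(b+c)=a*b\dotplus a*c$ for $a\in R_{-i,j}$, $b,c\in R_{ji}$; (R8) $a*b\dotplus\overline b*\overline a=\dot0$ for $a\in R_{-i,j},b\in R_{ji}$; (R9) $a+u\circ v=u\circ v+a$ for $u\in\Delta^0_i,v\in\Delta^0_j,a\in R_{-i,j}$; (R10) $(u\dotplus v)\circ w=u\circ w+v\circ w$ for $u,v\in\Delta^0_i,w\in\Delta^0_j$; (R11) $u\circ(v\dotplus w)=u\circ v+u\circ w$ for $u\in\Delta^0_i$, $v,w\in\Delta^0_j$; (R12) $\overline{u\circ v}=v\circ u$ for $u\in\Delta^0_i$, $v\in\Delta^0_j$; (R13) $u\circ(a*b)+u\triangleleft(-\overline a)+b=b+u\triangleleft(-\overline a)$ for $u\in\Delta^0_i,a\in R_{-j,-i},b\in R_{-i,j}$; (R14) $u\cdot a\dotplus v=v\dotplus u\cdot a\mathbin{\dot-}\overline a*(u\circ v)$ for $u\in\Delta^0_i,a\in R_{ij},v\in\Delta^0_j$; (R15) $(u\dotplus v)\cdot a=u\cdot a\dotplus v\cdot a$ for $u,v\in\Delta^0_i,a\in R_{ij}$; (R16) $(u\dotplus v)\triangleleft a=v\triangleleft a+u\circ(v\cdot(-a))+u\triangleleft a$ for $u,v\in\Delta^0_i,a\in R_{ij}$; (R17) $u\triangleleft(a+b)=u\triangleleft a+u\triangleleft b$ for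 $u\in\Delta^0_i$, $a,b\in R_{ij}$; (R18) $u\cdot(a+b)=u\cdot a\dotplus\overline b*(u\triangleleft a)\dotplus u\cdot b$ for $u\in\Delta^0_i$, $a,b\in R_{ij}$; (R19) $(ab)c=a(bc)$ for $a\in R_{ij},b\in R_{jk},c\in R_{kl}$; (R20) $ab*c=a*bc$ for $a\in R_{-i,j},b\in R_{jk},c\in R_{ki}$; (R21) $u\circ(a*b)=0$ for $u\in\Delta^0_i,a\in R_{-j,k},b\in R_{kj}$; (R22) $u\circ(v\cdot a)=(u\circ v)a$ for $u\in\Delta^0_i,v\in\Delta^0_j,a\in R_{jk}$; (R23) $\overline a(u\triangleleft b)+(u\cdot a)\circ(u\cdot b)+\overline{(u\triangleleft a)}b=0$ for $u\in\Delta^0_i,a\in R_{ij},b\in R_{ik}$; (R24) $(a*b)\triangleleft c=a(bc)-\overline b(\overline ac)$ for $a\in R_{-i,j},b\in R_{ji},c\in R_{ik}$; (R25) $(a*b)\cdot c=\overline ca*bc$ for $a\in R_{-i,j},b\in R_{ji},c\in R_{ik}$; (R26) $(u\triangleleft a)b=u\triangleleft ab$ for $u\in\Delta^0_i,a\in R_{ij},b\in R_{jk}$; (R27) $(\mathbin{\dot-}(u\cdot a))\triangleleft b=\overline{(u\triangleleft a)}(ab)$ for $u\in\Delta^0_i,a\in R_{ij},b\in R_{jk}$; (R28) $(u\cdot a)\cdot b=u\cdot ab$ for $u\in\Delta^0_i,a\in R_{ij},b\in R_{jk}$. It is called idempotent if $R_{ij}=\langle R_{ik}R_{kj},R_{i,-k}R_{-k,j}\rangle$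 and $\Delta^0_i=\langle\Delta^0_j\cdot R_{ji},\Delta^0_{-j}\cdot R_{-j,i},R_{-i,j}*R_{ji}\rangle$ for all non-zero indices with distinct absolute values. ($\langle X\rangle$ denotes the generated subgroup; $XY$, $X\cdot Y$, $X*Y$, $X\circ Y$ are the sets of values of the operations.) The associativity conditions: for all $a\in R_{ij}$, $b\in R_{jk}$, $c\in R_{kl}$, $d\in R_{lm}$, $e\in R_{mn}$ (non-zero indices), (A1) $a((b(cd))e)=((ab)c)(de)$ if $|i|=|m|$, $|j|=|l|$, $|k|=|n|$ are distinct; (A2) $(ab)(c(de))=(a((bc)d))e$ if $|i|=|l|$, $|j|=|n|$, $|k|=|m|$ are distinct; (A3) $((a(bc))d)e=a(b((cd)e))$ if $|i|=|k|$, $|j|=|m|$, $|l|=|n|$ are distinct; (A4) $((ab)(cd))e=a((bc)(de))$ if $|i|=|l|$, $|j|=|m|$, $|k|=|n|$ are distinct. *)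

(* Defs.v *)
From mathcomp Require Import all_boot ssralg ssrint.
From Stdlib Require Import StrictProp.

Set Implicit Arguments.
Unset Strict Implicit.
Unset Printing Implicit Defensive.

Declare Scope index_scope.
Delimit Scope index_scope with I.
Declare Scope ofr_scope.
Delimit Scope ofr_scope with ofr.

(* Non-zero integers i with |i| <= l.  The integer [ival i] is stored together
   with its opposite, and the defining condition is proof-irrelevant, so that
   [iopp (iopp i)] and [i] are convertible: a term of type R_{--i,j} can be
   used directly as a term of type R_{i,j}. *)
Local Set Primitive Projections.
Record sidx (l : nat) : Set := Sidx {
  ival : int;
  iopv : int;
  _sidx_ok : Squash (is_true
    [&& iopv == (- ival)%R, ival != 0%R & (`|ival|%N <= l)%N])
}.
Local Unset Primitive Projections.

Definition squash_map (P Q : Prop) (f : P -> Q) (s : Squash P) : Squash Q :=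
  match s with squash p => squash (f p) end.

Lemma sidx_ok_opp (l : nat) (x y : int) :
  [&& y == (- x)%R, x != 0%R & (`|x|%N <= l)%N] ->
  [&& x == (- y)%R, y != 0%R & (`|y|%N <= l)%N].
Proof.
by case/and3P=> /eqP-> x0 xl; rewrite GRing.opprK eqxx GRing.oppr_eq0 x0 abszN.
Qed.

Definition iopp (l : nat) (i : sidx l) : sidx l :=
  Sidx (squash_map (@sidx_ok_opp l _ _) (_sidx_ok i)).

Definition iabs (l : nat) (i : sidx l) : nat := `|ival i|%N.

Arguments iopp {l} i : simpl never.
Arguments iabs {l} i : simpl never.

Definition iabs_uniq (l : nat) (s : seq (sidx l)) : bool :=
  uniq [seq iabs i | i <- s].

Notation "- i" := (iopp i) : index_scope.
Bind Scope index_scope with sidx.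

(* Additive notation for groups that need not be commutative; it serves both
   the groups R_{ij} and the groups Delta_i. *)
Notation "x + y" := (monoid.mul x y) : ofr_scope.
Notation "- x" := (monoid.inv x) : ofr_scope.
Notation "x - y" := (monoid.mul x (monoid.inv y)) : ofr_scope.
Notation "0" := (@monoid.one _) : ofr_scope.

Inductive generated (G : groupType) (X : G -> Prop) : G -> Prop :=
| generated_sub x : X x -> generated X x
| generated_zero : generated X (0%ofr : G)
| generated_add x y :
    generated X x -> generated X y -> generated X (x + y)%ofr
| generated_opp x : generated X x -> generated X (- x)%ofr.

(* The families and the operations are total in the indices.  Only the values
   at indices with distinct absolute values are meaningful: the axioms and the
   properties below never involve the other ones.  The involution is written
   a^* and the product of R_{ij} and R_{jk}, usually a juxtaposition, a ⊗ b. *)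
Record pgofr_ops (l : nat) := PgofrOps {
  Rg : sidx l -> sidx l -> groupType;
  Dl : sidx l -> groupType;
  ofr_conj : forall i j, Rg i j -> Rg (- j) (- i);
  ofr_mul : forall i j k, Rg i j -> Rg j k -> Rg i k;
  ofr_star : forall i j, Rg (- i) j -> Rg j i -> Dl i;
  ofr_circ : forall i j, Dl i -> Dl j -> Rg (- i) j;
  ofr_tri : forall i j, Dl i -> Rg i j -> Rg (- i) j;
  ofr_act : forall i j, Dl i -> Rg i j -> Dl j
}.

Arguments ofr_conj {l p i j} a.
Arguments ofr_mul {l p i j k} a b.
Arguments ofr_star {l p i j} a b.
Arguments ofr_circ {l p i j} u v.
Arguments ofr_tri {l p i j} u a.
Arguments ofr_act {l p i j} u a.

Notation "a ^*" := (ofr_conj a) : ofr_scope.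
Notation "a ⊗ b" := (ofr_mul a b) (at level 40, left associativity) : ofr_scope.
Notation "a ∗ b" := (ofr_star a b) (at level 40, left associativity) : ofr_scope.
Notation "u ∘ v" := (ofr_circ u v) (at level 40, left associativity) : ofr_scope.
Notation "u ◁ a" := (ofr_tri u a) (at level 40, left associativity) : ofr_scope.
Notation "u ⋅ a" := (ofr_act u a) (at level 40, left associativity) : ofr_scope.

Local Open Scope ofr_scope.

Record pgofr_axioms (l : nat) (A : pgofr_ops l) : Prop := PgofrAxioms {
  conjD : forall i j, iabs_uniq [:: i; j] ->
    forall a b : Rg A i j, (a + b)^* = b^* + a^*;
  conjK : forall i j, iabs_uniq [:: i; j] ->
    forall a : Rg A i j, (a^*)^* = a;
  axR1 : forall i j k, iabs_uniq [:: i; j; k] ->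
    forall (a : Rg A i j) (b : Rg A j k) (c : Rg A i k),
    a ⊗ b + c = c + a ⊗ b;
  axR2 : forall i j k, iabs_uniq [:: i; j; k] ->
    forall (a b : Rg A i j) (c : Rg A j k),
    (a + b) ⊗ c = a ⊗ c + b ⊗ c;
  axR3 : forall i j k, iabs_uniq [:: i; j; k] ->
    forall (a : Rg A i j) (b c : Rg A j k),
    a ⊗ (b + c) = a ⊗ b + a ⊗ c;
  axR4 : forall i j k, iabs_uniq [:: i; j; k] ->
    forall (a : Rg A i j) (b : Rg A j k),
    (a ⊗ b)^* = b^* ⊗ a^*;
  axR5 : forall i j, iabs_uniq [:: i; j] ->
    forall (a : Rg A (- i) j) (b : Rg A j i) (u : Dl A i),
    a ∗ b + u = u + a ∗ b;
  axR6 : forall i j, iabs_uniq [:: i; j] ->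
    forall (a b : Rg A (- i) j) (c : Rg A j i),
    (a + b) ∗ c = a ∗ c + b ∗ c;
  axR7 : forall i j, iabs_uniq [:: i; j] ->
    forall (a : Rg A (- i) j) (b c : Rg A j i),
    a ∗ (b + c) = a ∗ b + a ∗ c;
  axR8 : forall i j, iabs_uniq [:: i; j] ->
    forall (a : Rg A (- i) j) (b : Rg A j i),
    a ∗ b + b^* ∗ a^* = 0;
  axR9 : forall i j, iabs_uniq [:: i; j] ->
    forall (u : Dl A i) (v : Dl A j) (a : Rg A (- i) j),
    a + u ∘ v = u ∘ v + a;
  axR10 : forall i j, iabs_uniq [:: i; j] ->
    forall (u v : Dl A i) (w : Dl A j),
    (u + v) ∘ w = u ∘ w + v ∘ w;
  axR11 : forall i j, iabs_uniq [:: i; j] ->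
    forall (u : Dl A i) (v w : Dl A j),
    u ∘ (v + w) = u ∘ v + u ∘ w;
  axR12 : forall i j, iabs_uniq [:: i; j] ->
    forall (u : Dl A i) (v : Dl A j),
    (u ∘ v)^* = v ∘ u;
  axR13 : forall i j, iabs_uniq [:: i; j] ->
    forall (u : Dl A i) (a : Rg A (- j) (- i)) (b : Rg A (- i) j),
    u ∘ (a ∗ b) + u ◁ (- a^*) + b = b + u ◁ (- a^*);
  axR14 : forall i j, iabs_uniq [:: i; j] ->
    forall (u : Dl A i) (a : Rg A i j) (v : Dl A j),
    u ⋅ a + v = v + u ⋅ a - a^* ∗ (u ∘ v);
  axR15 : forall i j, iabs_uniq [:: i; j] ->
    forall (u v : Dl A i) (a : Rg A i j),
    (u + v) ⋅ a = u ⋅ a + v ⋅ a;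
  axR16 : forall i j, iabs_uniq [:: i; j] ->
    forall (u v : Dl A i) (a : Rg A i j),
    (u + v) ◁ a = v ◁ a + u ∘ (v ⋅ (- a)) + u ◁ a;
  axR17 : forall i j, iabs_uniq [:: i; j] ->
    forall (u : Dl A i) (a b : Rg A i j),
    u ◁ (a + b) = u ◁ a + u ◁ b;
  axR18 : forall i j, iabs_uniq [:: i; j] ->
    forall (u : Dl A i) (a b : Rg A i j),
    u ⋅ (a + b) = u ⋅ a + b^* ∗ (u ◁ a) + u ⋅ b;
  axR19 : forall i j k m, iabs_uniq [:: i; j; k; m] ->
    forall (a : Rg A i j) (b : Rg A j k) (c : Rg A k m),
    (a ⊗ b) ⊗ c = a ⊗ (b ⊗ c);
  axR20 : forall i j k, iabs_uniq [:: i; j; k] ->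
    forall (a : Rg A (- i) j) (b : Rg A j k) (c : Rg A k i),
    (a ⊗ b) ∗ c = a ∗ (b ⊗ c);
  axR21 : forall i j k, iabs_uniq [:: i; j; k] ->
    forall (u : Dl A i) (a : Rg A (- j) k) (b : Rg A k j),
    u ∘ (a ∗ b) = 0;
  axR22 : forall i j k, iabs_uniq [:: i; j; k] ->
    forall (u : Dl A i) (v : Dl A j) (a : Rg A j k),
    u ∘ (v ⋅ a) = (u ∘ v) ⊗ a;
  axR23 : forall i j k, iabs_uniq [:: i; j; k] ->
    forall (u : Dl A i) (a : Rg A i j) (b : Rg A i k),
    a^* ⊗ (u ◁ b) + (u ⋅ a) ∘ (u ⋅ b) + (u ◁ a)^* ⊗ b = 0;
  axR24 : forall i j k, iabs_uniq [:: i; j; k] ->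
    forall (a : Rg A (- i) j) (b : Rg A j i) (c : Rg A i k),
    (a ∗ b) ◁ c = a ⊗ (b ⊗ c) - b^* ⊗ (a^* ⊗ c);
  axR25 : forall i j k, iabs_uniq [:: i; j; k] ->
    forall (a : Rg A (- i) j) (b : Rg A j i) (c : Rg A i k),
    (a ∗ b) ⋅ c = (c^* ⊗ a) ∗ (b ⊗ c);
  axR26 : forall i j k, iabs_uniq [:: i; j; k] ->
    forall (u : Dl A i) (a : Rg A i j) (b : Rg A j k),
    (u ◁ a) ⊗ b = u ◁ (a ⊗ b);
  axR27 : forall i j k, iabs_uniq [:: i; j; k] ->
    forall (u : Dl A i) (a : Rg A i j) (b : Rg A j k),
    (- (u ⋅ a)) ◁ b = (u ◁ a)^* ⊗ (a ⊗ b);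
  axR28 : forall i j k, iabs_uniq [:: i; j; k] ->
    forall (u : Dl A i) (a : Rg A i j) (b : Rg A j k),
    (u ⋅ a) ⋅ b = u ⋅ (a ⊗ b)
}.

(* Partial graded odd form rings of rank l, the groups R_{ij} and Delta^0_i
   being [Rg A i j] and [Dl A i]. *)
Record pgofr (l : nat) := Pgofr {
  pgofr_opsOf :> pgofr_ops l;
  pgofrP : pgofr_axioms pgofr_opsOf
}.

Definition pgofr_idempotent (l : nat) (A : pgofr l) : Prop :=
  (forall i j k, iabs_uniq [:: i; j; k] -> forall x : Rg A i j,
     generated (fun y : Rg A i j =>
       (exists (a : Rg A i k) (b : Rg A k j), y = a ⊗ b) \/
       (exists (a : Rg A i (- k)) (b : Rg A (- k) j), y = a ⊗ b)) x) /\
  (forall i j, iabs_uniq [:: i; j] -> forall u : Dl A i,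
     generated (fun w : Dl A i =>
       [\/ exists (v : Dl A j) (a : Rg A j i), w = v ⋅ a,
           exists (v : Dl A (- j)) (a : Rg A (- j) i), w = v ⋅ a
         | exists (a : Rg A (- i) j) (b : Rg A j i), w = a ∗ b]) u).

Definition circ_generated (l : nat) (A : pgofr l) : Prop :=
  forall i j, iabs_uniq [:: i; j] -> forall x : Rg A i j,
    generated (fun y : Rg A i j =>
      exists (u : Dl A (- i)) (v : Dl A j), y = u ∘ v) x.

Definition assocA1 (l : nat) (A : pgofr l) : Prop :=
  forall i j k p m n, iabs i = iabs m -> iabs j = iabs p -> iabs k = iabs n ->
  iabs_uniq [:: i; j; k] ->
  forall (a : Rg A i j) (b : Rg A j k) (c : Rg A k p) (d : Rg A p m)
    (e : Rg A m n),
  a ⊗ ((b ⊗ (c ⊗ d)) ⊗ e) = ((a ⊗ b) ⊗ c) ⊗ (d ⊗ e).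

Definition assocA2 (l : nat) (A : pgofr l) : Prop :=
  forall i j k p m n, iabs i = iabs p -> iabs j = iabs n -> iabs k = iabs m ->
  iabs_uniq [:: i; j; k] ->
  forall (a : Rg A i j) (b : Rg A j k) (c : Rg A k p) (d : Rg A p m)
    (e : Rg A m n),
  (a ⊗ b) ⊗ (c ⊗ (d ⊗ e)) = (a ⊗ ((b ⊗ c) ⊗ d)) ⊗ e.

Definition assocA3 (l : nat) (A : pgofr l) : Prop :=
  forall i j k p m n, iabs i = iabs k -> iabs j = iabs m -> iabs p = iabs n ->
  iabs_uniq [:: i; j; p] ->
  forall (a : Rg A i j) (b : Rg A j k) (c : Rg A k p) (d : Rg A p m)
    (e : Rg A m n),
  ((a ⊗ (b ⊗ c)) ⊗ d) ⊗ e = a ⊗ (b ⊗ ((c ⊗ d) ⊗ e)).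

Definition assocA4 (l : nat) (A : pgofr l) : Prop :=
  forall i j k p m n, iabs i = iabs p -> iabs j = iabs m -> iabs k = iabs n ->
  iabs_uniq [:: i; j; k] ->
  forall (a : Rg A i j) (b : Rg A j k) (c : Rg A k p) (d : Rg A p m)
    (e : Rg A m n),
  ((a ⊗ b) ⊗ (c ⊗ d)) ⊗ e = a ⊗ ((b ⊗ c) ⊗ (d ⊗ e)).

Definition associativity_conditions (l : nat) (A : pgofr l) : Prop :=
  [/\ assocA1 A, assocA2 A, assocA3 A & assocA4 A].

(* Main.v *)
(* In each of the four identities both sides are additive in the middle factor
   c, so c may be taken to be a generator.  For l >= 4 idempotence factors c
   through an index h with |h| different from the three absolute values that
   occur, and every product is then reassociated by (R19).  In the other case
   c = u ∘ v, and by (R22) and its conjugate both sides become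
   (u ⋅ b^* ⋅ a^* ) ∘ (v ⋅ d ⋅ e), up to (R28). *)
Require Import Defs.
From mathcomp Require Import all_boot.
From Stdlib Require Import StrictProp.
From mathcomp Require Import ssralg ssrint zify.

Set Implicit Arguments.
Unset Strict Implicit.
Unset Printing Implicit Defensive.

Local Open Scope ofr_scope.

(* [Squash] only eliminates into [SProp]; decidability of [b] is what lets the
   proof pass through [sEmpty]. *)
Lemma unsquash (b : bool) : Squash (is_true b) -> b.
Proof.
case: b => // s; refine (sEmpty_ind (fun=> _) _).
refine match s with squash p => _ end; discriminate p.
Qed.

Lemma iabsN (l : nat) (i : sidx l) : iabs (- i)%I = iabs i.
Proof.
by rewrite /iabs /=; have /and3P[/eqP-> _ _] := unsquash (_sidx_ok i); lia.
Qed.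

Lemma sidx_of_nat_ok (l q : nat) : 0 < q <= l ->
  [&& (- Posz q)%R == (- Posz q)%R, Posz q != 0%R & (`|Posz q|%N <= l)%N].
Proof. by move=> q_ok; apply/and3P; split; lia. Qed.

Lemma exists_fresh_index (l : nat) (i j k : sidx l) : 4 <= l ->
  exists h : sidx l, [/\ iabs h != iabs i, iabs h != iabs j & iabs h != iabs k].
Proof.
move=> l4.
have [q [q_ok qi qj qk]] : exists q,
    [/\ 0 < q <= l, q != iabs i, q != iabs j & q != iabs k].
  move: (iabs i) (iabs j) (iabs k) => x y z.
  (* Three values cannot exhaust the four candidates, all of which are at most [l]. *)
  have /hasP[q] : has [pred q | q \notin [:: x; y; z]] [:: 1; 2; 3; 4].
    by rewrite /= !inE; lia.
  by rewrite !inE => q_in q_out; exists q; split; lia.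
by exists (Sidx (squash (sidx_of_nat_ok q_ok))).
Qed.

(** Once [iabsN] erases signs, distinctness is linear arithmetic in the absolute values; equalities
    such as [iabs i = iabs m] come from the context. *)
Ltac solve_uniq :=
  repeat match goal with ijk : is_true (iabs_uniq _) |- _ => move: ijk end;
  rewrite /iabs_uniq /= ?inE ?iabsN; lia.

#[local] Hint Extern 0 (is_true (iabs_uniq _)) => solve_uniq : core.

Lemma additive_eq_on_generated (G H : groupType) (X : G -> Prop)
    (f g : G -> H) :
    (forall x y, f (x + y) = f x + f y) ->
    (forall x y, g (x + y) = g x + g y) ->
    (forall x, X x -> f x = g x) ->
  forall x, generated X x -> f x = g x.
Proof.
move=> fD gD fg.
have morph0 (h : G -> H) : (forall x y, h (x + y) = h x + h y) -> h 0 = 0.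
  by move=> hD; apply: (@monoid.mulIg _ (h 0)); rewrite -hD !monoid.mul1g.
have morphN (h : G -> H) : (forall x y, h (x + y) = h x + h y) ->
    forall x, h (- x) = - h x.
  move=> hD x; apply: (@monoid.mulIg _ (h x)).
  by rewrite -hD !monoid.mulVg morph0.
move=> x; elim=> [y /fg //||y z _ IHy _ IHz|y _ IHy].
- by rewrite !morph0.
- by rewrite fD gD IHy IHz.
- by rewrite !morphN ?IHy.
Qed.

Section Products.
Variables (l : nat) (A : pgofr l).

Let AP := pgofrP A.

Lemma mulA (i j k m : sidx l) (a : Rg A i j) (b : Rg A j k) (c : Rg A k m) :
  iabs_uniq [:: i; j; k; m] -> a ⊗ b ⊗ c = a ⊗ (b ⊗ c).
Proof. by move=> u; rewrite (axR19 AP). Qed.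

Lemma circ_mul (i j k : sidx l) (u : Dl A (- i)) (v : Dl A j) (a : Rg A j k) :
  iabs_uniq [:: i; j; k] ->
  (u ∘ v : Rg A i j) ⊗ a = (u ∘ (v ⋅ a) : Rg A i k).
Proof. by move=> ijk; rewrite (axR22 AP). Qed.

(** This is the conjugate of (R22): conjugation reverses products by (R4) and swaps [u] and [v] by
    (R12). *)
Lemma mul_circ (i j k : sidx l) (a : Rg A i j) (u : Dl A (- j)) (v : Dl A k) :
  iabs_uniq [:: i; j; k] ->
  a ⊗ (u ∘ v : Rg A j k) = ((u ⋅ a^*) ∘ v : Rg A i k).
Proof.
move=> ijk.
have conj_uv : (u ∘ v : Rg A j k)^* = v ∘ u.
  by apply: (axR12 AP (i := (- j)%I)).
have conj_vu : (v ∘ (u ⋅ a^*))^* = (u ⋅ a^*) ∘ v.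
  by apply: (axR12 AP (j := (- i)%I)).
rewrite -(conjK AP _ (a ⊗ _)) // (axR4 AP) // conj_uv -conj_vu.
apply: (congr1 (@ofr_conj _ A (- k)%I (- i)%I)); symmetry.
by apply: (axR22 AP).
Qed.

Lemma act_conj_mul (i j k : sidx l) (u : Dl A (- k)) (a : Rg A i j)
    (b : Rg A j k) :
  iabs_uniq [:: i; j; k] -> u ⋅ (a ⊗ b)^* = u ⋅ b^* ⋅ a^*.
Proof. by move=> ijk; rewrite (axR4 AP) // (axR28 AP). Qed.

Lemma act_mul (i j k : sidx l) (u : Dl A i) (a : Rg A i j) (b : Rg A j k) :
  iabs_uniq [:: i; j; k] -> u ⋅ (a ⊗ b) = u ⋅ a ⋅ b.
Proof. by move=> ijk; rewrite (axR28 AP). Qed.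

Hypothesis (hA : pgofr_idempotent A) (H : 4 <= l \/ circ_generated A).

(* The index t carries the third absolute value that the factor h avoids. *)
Lemma eq_on_products_and_circs (i j t : sidx l) (G : groupType)
    (f g : Rg A i j -> G) :
    iabs_uniq [:: i; j; t] ->
    (forall x y, f (x + y) = f x + f y) ->
    (forall x y, g (x + y) = g x + g y) ->
    (forall h, iabs_uniq [:: h; i; j; t] ->
       forall (a : Rg A i h) (b : Rg A h j), f (a ⊗ b) = g (a ⊗ b)) ->
    (forall (u : Dl A (- i)) (v : Dl A j), f (u ∘ v) = g (u ∘ v)) ->
  f =1 g.
Proof.
move=> ijt fD gD fg_mul fg_circ x; case: H => [l4|circA].
  have [h [hi hj ht]] := exists_fresh_index i j t l4.
  apply: (additive_eq_on_generated fD gD _ (hA.1 i j h _ x)) => //.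
  (* Idempotence factors through [h] or [- h]; both have the same absolute value, so [fg_mul] covers
     both. *)
  by move=> _ [] [a [b ->]]; apply: fg_mul.
by apply: (additive_eq_on_generated fD gD _ (circA i j _ x)) => // _ [u [v ->]].
Qed.

Lemma idempotent_assocA1 : assocA1 A.
Proof.
move=> i j k p m n im jp kn ijk a b c d e.
(* Since |p| = |j|, the absolute value missing from [Rg A k p] is |i|. *)
apply: (@eq_on_products_and_circs _ _ i _
          (fun c => a ⊗ ((b ⊗ (c ⊗ d)) ⊗ e)) (fun c => ((a ⊗ b) ⊗ c) ⊗ (d ⊗ e))).
- by [].
- by move=> x y; rewrite !(axR2 AP, axR3 AP).
- by move=> x y; rewrite !(axR2 AP, axR3 AP).
- move=> h hU c1 c2.
  (* Both sides become [((a ⊗ b) ⊗ c1) ⊗ (c2 ⊗ (d ⊗ e))], split at the new index [h]. *)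
  rewrite (mulA c1 c2 d) // -(mulA b c1 (c2 ⊗ d)) // (mulA (b ⊗ c1) (c2 ⊗ d) e) //.
  by rewrite (mulA c2 d e) // -(mulA a (b ⊗ c1) _) // -(mulA a b c1) //
    -(mulA (a ⊗ b) c1 c2) // (mulA _ c2 (d ⊗ e)).
- by move=> u v; rewrite !(circ_mul, mul_circ, act_conj_mul, act_mul).
Qed.

Lemma idempotent_assocA2 : assocA2 A.
Proof.
move=> i j k p m n ip jn km ijk a b c d e.
apply: (@eq_on_products_and_circs _ _ j _
          (fun c => (a ⊗ b) ⊗ (c ⊗ (d ⊗ e))) (fun c => (a ⊗ ((b ⊗ c) ⊗ d)) ⊗ e)).
- by [].
- by move=> x y; rewrite !(axR2 AP, axR3 AP).
- by move=> x y; rewrite !(axR2 AP, axR3 AP).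
- move=> h hU c1 c2.
  rewrite -(mulA b c1 c2) // (mulA (b ⊗ c1) c2 d) // -(mulA a _ (c2 ⊗ d)) //
    -(mulA a b c1) //.
  by rewrite (mulA _ (c2 ⊗ d) e) // (mulA c2 d e) // (mulA c1 c2 (d ⊗ e)) //
    -(mulA (a ⊗ b) c1 _).
- by move=> u v; rewrite !(circ_mul, mul_circ, act_conj_mul, act_mul).
Qed.

Lemma idempotent_assocA3 : assocA3 A.
Proof.
move=> i j k p m n ik jm pn ijp a b c d e.
apply: (@eq_on_products_and_circs _ _ j _
          (fun c => ((a ⊗ (b ⊗ c)) ⊗ d) ⊗ e) (fun c => a ⊗ (b ⊗ ((c ⊗ d) ⊗ e)))).
- by [].
- by move=> x y; rewrite !(axR2 AP, axR3 AP).
- by move=> x y; rewrite !(axR2 AP, axR3 AP).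
- move=> h hU c1 c2.
  (* The common value is [(a ⊗ (b ⊗ c1)) ⊗ ((c2 ⊗ d) ⊗ e)]: as |i| = |k| and |p| = |n|, the products
     [a ⊗ b] and [d ⊗ e] must be avoided. *)
  rewrite -(mulA b c1 c2) // -(mulA a (b ⊗ c1) c2) // (mulA _ c2 d) //
    (mulA _ (c2 ⊗ d) e) //.
  by rewrite (mulA c1 c2 d) // (mulA c1 (c2 ⊗ d) e) // -(mulA b c1 _) //
    -(mulA a (b ⊗ c1) _).
- by move=> u v; rewrite !(circ_mul, mul_circ).
Qed.

Lemma idempotent_assocA4 : assocA4 A.
Proof.
move=> i j k p m n ip jm kn ijk a b c d e.
apply: (@eq_on_products_and_circs _ _ j _
          (fun c => ((a ⊗ b) ⊗ (c ⊗ d)) ⊗ e) (fun c => a ⊗ ((b ⊗ c) ⊗ (d ⊗ e)))).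
- by [].
- by move=> x y; rewrite !(axR2 AP, axR3 AP).
- by move=> x y; rewrite !(axR2 AP, axR3 AP).
- move=> h hU c1 c2.
  (* The common value is again [((a ⊗ b) ⊗ c1) ⊗ (c2 ⊗ (d ⊗ e))]. *)
  rewrite (mulA c1 c2 d) // -(mulA (a ⊗ b) c1 (c2 ⊗ d)) // (mulA _ (c2 ⊗ d) e) //
    (mulA c2 d e) //.
  by rewrite -(mulA b c1 c2) // (mulA _ c2 (d ⊗ e)) // -(mulA a (b ⊗ c1) _) //
    -(mulA a b c1).
- by move=> u v; rewrite !(circ_mul, mul_circ, act_conj_mul, act_mul).
Qed.

End Products.

Theorem theorem1 (l : nat) (hl : 3 <= l) (A : pgofr l)
  (hA : pgofr_idempotent A) :
  4 <= l \/ circ_generated A -> associativity_conditions A.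
Proof.
move=> H; split.
- exact: idempotent_assocA1.
- exact: idempotent_assocA2.
- exact: idempotent_assocA3.
- exact: idempotent_assocA4.
Qed.
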